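(* Let $1\le p<\infty$, let $(\mathcal M,\Sigma,\mu)$ be a measure space (not required to be $\sigma$-finite), and let $T$ be a positive operator on $L^p(\mathcal M)$ that is strongly Kreiss bounded. Then there exist $C,\kappa>0$ such that for every integer $N\ge1$, $$\|T^N\|\le C\,N^{1/\bar p}\,\log^\kappa(N+1),$$ where $\bar p=\max\left(p,\frac{p}{p-1}\right)$ (so $\bar p=\infty$ and $1/\bar p=0$ when $p=1$).
   Context: Banach spaces are complex. A bounded linear operator $T$ on a Banach space $X$ is called strongly Kreiss bounded if $\sigma(T)\subset\overline{\mathbb D}$ (the closed unit disk) and there is $C>0$ such that $\|(\lambda-T)^{-k}\|\le \frac{C}{(|\lambda|-1)^k}$ for all $\lambda\in\mathbb C$ with $|\lambda|>1$ and all integers $k\ge1$; equivalently, there is $L>0$ with $\|e^{zT}\|\le Le^{|z|}$ for all $z\in\mathbb C$. An operator $T$ on $L^p(\mathcal M)$ is positive if $Tx\ge0$ whenever $x\ge0$. Here $\log^\kappa(x)$ means $(\log x)^\kappa$. *)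

(* Defs.v *)
From HB Require Import structures.
From mathcomp Require Import all_boot all_order all_algebra.
From mathcomp Require Import complex.
From mathcomp Require Import all_classical all_reals all_analysis measurable_realfun
  ess_sup_inf.

Set Implicit Arguments.
Unset Strict Implicit.
Unset Printing Implicit Defensive.

Import Order.TTheory GRing.Theory Num.Theory.
Import numFieldNormedType.Exports.

Local Open Scope classical_set_scope.
Local Open Scope ring_scope.
Local Open Scope quotient_scope.

Arguments complex.Re {R} _.
Arguments complex.Im {R} _.

(* R[i] carries an R[i]-valued norm [`|z|] and the partial order for which
   [0 <= z] means that z is a nonnegative real; [Normc.normc z : R] is the
   modulus of z as an element of R. *)

Section complex_functions.
Context d (Omega : measurableType d) (R : realType).
Variable mu : {measure set Omega -> \bar R}.
Implicit Types f g : Omega -> R[i].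

Definition cmeasurable f :=
  measurable_fun setT (complex.Re \o f) /\ measurable_fun setT (complex.Im \o f).

Definition cLnorm (p : \bar R) f : \bar R :=
  'N[mu]_p[EFin \o (@Normc.normc R \o f)].

Lemma normc_ge0 (z : R[i]) : 0 <= Normc.normc z.
Proof. by case: z => a b; exact: sqrtr_ge0. Qed.

Lemma norm_normc (z : R[i]) : `|z| = (Normc.normc z)%:C%C.
Proof. by case: z. Qed.

Lemma Re_norm (z : R[i]) : complex.Re `|z| = Normc.normc z.
Proof. by rewrite norm_normc. Qed.

Lemma ReDc (x y : R[i]) : complex.Re (x + y) = complex.Re x + complex.Re y.
Proof. by case: x y => [a b] [c e]. Qed.

Lemma ImDc (x y : R[i]) : complex.Im (x + y) = complex.Im x + complex.Im y.
Proof. by case: x y => [a b] [c e]. Qed.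

Lemma ReMc (x y : R[i]) : complex.Re (x * y) =
  complex.Re x * complex.Re y - complex.Im x * complex.Im y.
Proof. by case: x y => [a b] [c e]. Qed.

Lemma ImMc (x y : R[i]) : complex.Im (x * y) =
  complex.Re x * complex.Im y + complex.Im x * complex.Re y.
Proof. by case: x y => [a b] [c e]. Qed.

Lemma cmeasurable0 : cmeasurable (0 : Omega -> R[i]).
Proof. by split; exact: measurable_cst. Qed.

Lemma cmeasurableD f g : cmeasurable f -> cmeasurable g -> cmeasurable (f + g).
Proof.
move=> [mf mf'] [mg mg']; split.
- rewrite [X in measurable_fun _ X](_ : _ =
    (complex.Re \o f) \+ (complex.Re \o g)); first exact: measurable_funD.
  by apply/funext => x /=; rewrite -ReDc.
- rewrite [X in measurable_fun _ X](_ : _ =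
    (complex.Im \o f) \+ (complex.Im \o g)); first exact: measurable_funD.
  by apply/funext => x /=; rewrite -ImDc.
Qed.

Lemma cmeasurableZ (a : R[i]) f : cmeasurable f -> cmeasurable (a *: f).
Proof.
move=> [mf mf']; split.
- rewrite [X in measurable_fun _ X](_ : _ =
    (cst (complex.Re a) \* (complex.Re \o f)) \-
    (cst (complex.Im a) \* (complex.Im \o f))); last first.
    by apply/funext => x /=; rewrite -ReMc.
  by apply: measurable_funB; apply: measurable_funM.
- rewrite [X in measurable_fun _ X](_ : _ =
    (cst (complex.Re a) \* (complex.Im \o f)) \+
    (cst (complex.Im a) \* (complex.Re \o f))); last first.
    by apply/funext => x /=; rewrite -ImMc.
  by apply: measurable_funD; apply: measurable_funM.
Qed.

Lemma cmeasurable_normc f :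
  cmeasurable f -> measurable_fun setT (@Normc.normc R \o f).
Proof.
move=> [mf mf'].
rewrite [X in measurable_fun _ X](_ : _ = (fun x =>
  ((complex.Re (f x)) ^+ 2 + (complex.Im (f x)) ^+ 2) `^ 2^-1)); last first.
  by apply/funext => x /=; case: (f x) => a b /=; rewrite powR12_sqrt// addr_ge0 ?sqr_ge0.
apply: (@measurableT_comp _ _ _ _ _ _ (@powR R ^~ 2^-1)) => //.
by apply: measurable_funD; exact: measurable_funX.
Qed.

Lemma cLnorm_ge0 p f : (0 <= cLnorm p f)%E.
Proof. exact: Lnorm_ge0. Qed.

Lemma ae_le_Lnorm (p : \bar R) (f g : Omega -> R) : (1 <= p)%E ->
  measurable_fun setT f -> measurable_fun setT g ->
  {ae mu, forall x, `|f x| <= `|g x|} ->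
  ('N[mu]_p[EFin \o f] <= 'N[mu]_p[EFin \o g])%E.
Proof.
case: p => [r|_|//].
- rewrite lee_fin => r1 mf mg fg.
  have r0 : 0 <= r by exact: le_trans r1.
  have mpow (h : Omega -> R) : measurable_fun setT h ->
      measurable_fun setT (fun x => (`|(EFin \o h) x| `^ r)%E).
    move=> mh; rewrite [X in measurable_fun _ X](_ : _ =
      EFin \o (fun x => `|h x| `^ r)); last exact/funext.
    apply/measurable_EFinP.
    apply: (@measurableT_comp _ _ _ _ _ _ (@powR R ^~ r)) => //.
    exact: measurableT_comp.
  rewrite unlock; apply: gt0_ler_poweR.
  + by rewrite invr_ge0.
  + by rewrite in_itv /= leey andbT integral_ge0// => x _; exact: poweR_ge0.
  + by rewrite in_itv /= leey andbT integral_ge0// => x _; exact: poweR_ge0.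
  apply: ae_ge0_le_integral => //.
  + by move=> x _; exact: poweR_ge0.
  + exact: mpow.
  + by move=> x _; exact: poweR_ge0.
  + exact: mpow.
  + apply: filterS fg => x fg _ /=.
    by rewrite lee_fin; apply: ge0_ler_powR; rewrite // nnegrE.
- move=> mf mg fg; rewrite unlock; case: ifPn => // mu0.
  by apply: le_ess_sup; apply: filterS fg => x /=; rewrite lee_fin.
Qed.

Lemma ae_eq_cLnorm (p : \bar R) f g : (1 <= p)%E ->
  cmeasurable f -> cmeasurable g -> {ae mu, forall x, f x = g x} ->
  cLnorm p f = cLnorm p g.
Proof.
move=> p1 /cmeasurable_normc mf /cmeasurable_normc mg fg.
by apply/eqP; rewrite eq_le; apply/andP; split; apply: ae_le_Lnorm => //;
  apply: filterS fg => x /= ->.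
Qed.

Lemma le_cLnormD (p : \bar R) f g : (1 <= p)%E ->
  cmeasurable f -> cmeasurable g ->
  (cLnorm p (f + g)%R <= cLnorm p f + cLnorm p g)%E.
Proof.
move=> p1 mf mg; have [nf ng] := (cmeasurable_normc mf, cmeasurable_normc mg).
apply: (le_trans _ (eminkowski mu nf ng p1)).
apply: ae_le_Lnorm => //.
- exact/cmeasurable_normc/cmeasurableD.
- exact: measurable_funD.
- apply/nearW => x /=; rewrite !ger0_norm ?addr_ge0 ?normc_ge0//.
  exact: le_normcD.
Qed.

Lemma cLnormZ (p : \bar R) (p1 : (1 <= p)%E) (a : R[i]) f :
  cmeasurable f -> (cLnorm p f < +oo)%E ->
  cLnorm p (a *: f)%R = ((Normc.normc a)%:E * cLnorm p f)%E.
Proof.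
move=> mf lf.
have nf : @Normc.normc R \o f \in Lfun mu p.
  by rewrite inE; apply/andP; split; rewrite inE//; exact: cmeasurable_normc.
have := LnormZ (Lfun_Sub p1 nf) (Normc.normc a).
rewrite ger0_norm ?normc_ge0// => <-; rewrite /cLnorm; apply: eq_Lnorm => x /=.
by rewrite Normc.normcM.
Qed.

Lemma cLnorm_eq0 (p : \bar R) f : (1 <= p)%E -> cmeasurable f ->
  cLnorm p f = 0 -> {ae mu, forall x, f x = 0}.
Proof.
move=> p1 /cmeasurable_normc mf /Lnorm_eq0_eq0.
have /[swap] /[apply] : measurable_fun setT (EFin \o (@Normc.normc R \o f)).
  exact/measurable_EFinP.
move=> /(_ (lt_le_trans lte01 p1)).
by apply: filterS => x /(_ I) /= [] /Normc.eq0_normc.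
Qed.

End complex_functions.

Section Lp_space.
Context d (Omega : measurableType d) (R : realType).
Variables (mu : {measure set Omega -> \bar R}) (p : \bar R) (p1 : (1 <= p)%E).

(* [p1] is a dummy argument here: it lets the instances below be found. *)
Definition cLfun of (1 <= p)%E : {pred Omega -> R[i]} :=
  mem [set f | cmeasurable f /\ (cLnorm mu p f < +oo)%E].

Lemma cLfun_submod_closed : submod_closed (cLfun p1).
Proof.
have cL0 : cLnorm mu p (0 : Omega -> R[i]) = 0%E.
  rewrite /cLnorm -(@Lnorm0 _ _ _ mu p).
    by apply: eq_Lnorm => x /=; rewrite expr0n /= addr0 sqrtr0.
  by rewrite gt_eqF// (lt_le_trans _ p1).
split; first by rewrite inE; split; [exact: cmeasurable0|rewrite cL0].
move=> a f g /[!inE] -[mf lf] [mg lg].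
have maf := cmeasurableZ a mf.
split; first exact: cmeasurableD.
rewrite (le_lt_trans (le_cLnormD mu p1 maf mg))// lte_add_pinfty//.
by rewrite cLnormZ// lte_mul_pinfty// ?lee_fin ?normc_ge0.
Qed.

HB.instance Definition _ :=
  GRing.isSubmodClosed.Build _ _ (cLfun p1) cLfun_submod_closed.

Record cLfunType := CLfun {
  cLfun_val :> Omega -> R[i];
  cLfun_valP : cLfun_val \in cLfun p1 }.

HB.instance Definition _ := [isSub for cLfun_val].
HB.instance Definition _ := gen_eqMixin cLfunType.
HB.instance Definition _ := gen_choiceMixin cLfunType.
HB.instance Definition _ := [SubChoice_isSubZmodule of cLfunType by <:].

Definition cLfun_scale (a : R[i]) (f : cLfunType) : cLfunType :=
  CLfun (@rpredZ _ _ (cLfun p1) a (cLfun_val f) (cLfun_valP f)).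

Lemma cLfun_scaleA a b f : cLfun_scale a (cLfun_scale b f) = cLfun_scale (a * b) f.
Proof. by apply: val_inj; rewrite /= scalerA. Qed.

Lemma cLfun_scale1 : left_id 1 cLfun_scale.
Proof. by move=> f; apply: val_inj; rewrite /= scale1r. Qed.

Lemma cLfun_scaleDr : right_distributive cLfun_scale +%R.
Proof. by move=> a f g; apply: val_inj; rewrite /= scalerDr. Qed.

Lemma cLfun_scaleDl f : {morph cLfun_scale^~ f : a b / a + b}.
Proof. by move=> a b; apply: val_inj; rewrite /= scalerDl. Qed.

HB.instance Definition _ := GRing.Zmodule_isLmodule.Build R[i] cLfunType
  cLfun_scaleA cLfun_scale1 cLfun_scaleDr cLfun_scaleDl.

Lemma cLfunP (f : cLfunType) : cmeasurable f /\ (cLnorm mu p f < +oo)%E.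
Proof. by have := cLfun_valP f; rewrite inE. Qed.

Lemma cLfun_valD (f g : cLfunType) x : (f + g) x = f x + g x.
Proof. by []. Qed.

Lemma cLfun_valB (f g : cLfunType) x : (f - g) x = f x - g x.
Proof. by []. Qed.

Lemma cLfun_valZ (a : R[i]) (f : cLfunType) x : (a *: f) x = a * f x.
Proof. by []. Qed.

Definition ae_null : {pred cLfunType} :=
  mem [set f : cLfunType | {ae mu, forall x, f x = 0}].

Lemma ae_null_zmod_closed : zmod_closed ae_null.
Proof.
split; first by rewrite inE; exact: nearW.
move=> f g /[!inE]/= f0 g0; apply: filterS2 f0 g0 => x f0 g0.
by rewrite -[LHS]/(f x - g x) f0 g0 subr0.
Qed.

HB.instance Definition _ :=
  GRing.isZmodClosed.Build _ ae_null ae_null_zmod_closed.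

Definition Lp : Type := Quotient.quot ae_null.

HB.instance Definition _ := EqQuotient.on Lp.
HB.instance Definition _ := GRing.Zmodule.on Lp.
HB.instance Definition _ := Choice.on Lp.

Definition Lp_fun (x : Lp) : Omega -> R[i] := repr x : cLfunType.
Coercion Lp_fun : Lp >-> Funclass.

Lemma Lp_piP (f g : cLfunType) :
  \pi_Lp f = \pi_Lp g <-> {ae mu, forall x, f x = g x}.
Proof.
split.
  move/eqP; rewrite -Quotient.idealrBE inE /=; apply: filterS => x.
  by move=> /eqP; rewrite subr_eq0 => /eqP.
move=> fg; apply/eqP; rewrite -Quotient.idealrBE inE /=.
by apply: filterS fg => x fg; rewrite -[LHS]/(f x - g x) fg subrr.
Qed.

Lemma Lp_piE (f : cLfunType) : {ae mu, forall x, Lp_fun (\pi_Lp f) x = f x}.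
Proof. by apply/Lp_piP; rewrite reprK. Qed.

Lemma LpP (x y : Lp) : x = y <-> {ae mu, forall t, x t = y t}.
Proof. by rewrite -[in X in X <-> _](reprK x) -[in X in X <-> _](reprK y) Lp_piP. Qed.

Lemma Lp_piD (f g : cLfunType) :
  (\pi_Lp f : Lp) + (\pi_Lp g : Lp) = \pi_Lp (f + g).
Proof. exact/esym/Quotient.pi_add. Qed.

Definition Lp_scale (a : R[i]) (x : Lp) : Lp := \pi_Lp (a *: repr x).

Lemma Lp_scale_pi (a : R[i]) (f : cLfunType) :
  Lp_scale a (\pi_Lp f) = \pi_Lp (a *: f).
Proof.
apply/Lp_piP; apply: filterS (Lp_piE f) => x fx.
by rewrite -[LHS]/(a * Lp_fun (\pi_Lp f) x) fx.
Qed.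

Lemma Lp_scaleA a b (x : Lp) : Lp_scale a (Lp_scale b x) = Lp_scale (a * b) x.
Proof.
elim/quotW: x => f; rewrite (Lp_scale_pi b f) (Lp_scale_pi a (b *: f)).
by rewrite (Lp_scale_pi (a * b) f) scalerA.
Qed.

Lemma Lp_scale1 : left_id 1 Lp_scale.
Proof. by elim/quotW => f; rewrite Lp_scale_pi scale1r. Qed.

Lemma Lp_scaleDr : right_distributive Lp_scale +%R.
Proof.
move=> a; elim/quotW => f; elim/quotW => g.
rewrite (Lp_piD f g) !Lp_scale_pi scalerDr.
exact/esym/Lp_piD.
Qed.

Lemma Lp_scaleDl x : {morph Lp_scale^~ x : a b / a + b}.
Proof.
elim/quotW: x => f a b; rewrite !Lp_scale_pi scalerDl.
exact/esym/Lp_piD.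
Qed.

HB.instance Definition _ := GRing.Zmodule_isLmodule.Build R[i] Lp
  Lp_scaleA Lp_scale1 Lp_scaleDr Lp_scaleDl.

Lemma Lp_addE (x y : Lp) : {ae mu, forall t, Lp_fun (x + y) t = x t + y t}.
Proof.
have -> : x + y = \pi_Lp (repr x + repr y) :> Lp by rewrite -Lp_piD !reprK.
exact: Lp_piE.
Qed.

Lemma Lp_scaleE (a : R[i]) (x : Lp) : {ae mu, forall t, Lp_fun (a *: x) t = a * x t}.
Proof. exact: Lp_piE. Qed.

Definition Lp_norm (x : Lp) : R[i] := (fine (cLnorm mu p x))%:C%C.

Lemma cLnorm_Lp_fin (x : Lp) : (fine (cLnorm mu p x))%:E = cLnorm mu p x.
Proof.
rewrite fineK// ge0_fin_numE ?cLnorm_ge0//.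
by have [] := cLfunP (repr x).
Qed.

Lemma Lp_normD x y : Lp_norm (x + y) <= Lp_norm x + Lp_norm y.
Proof.
rewrite /Lp_norm -rmorphD lecR -lee_fin EFinD !cLnorm_Lp_fin.
have [mx _] := cLfunP (repr x); have [my _] := cLfunP (repr y).
have [mxy _] := cLfunP (repr (x + y)).
apply: le_trans (le_cLnormD mu p1 mx my).
by rewrite (ae_eq_cLnorm p1 mxy (cmeasurableD mx my))//; exact: Lp_addE.
Qed.

Lemma Lp_normZ (a : R[i]) x : Lp_norm (a *: x) = `|a| * Lp_norm x.
Proof.
rewrite /Lp_norm norm_normc -rmorphM; congr (_%:C)%C; apply: EFin_inj.
rewrite EFinM !cLnorm_Lp_fin.
have [mx lx] := cLfunP (repr x); have [max _] := cLfunP (repr (a *: x)).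
rewrite -cLnormZ//; apply: ae_eq_cLnorm => //; first exact: cmeasurableZ.
exact: Lp_scaleE.
Qed.

Lemma Lp_norm0_eq0 x : Lp_norm x = 0 -> x = 0.
Proof.
move=> [] x0; have [mx lx] := cLfunP (repr x).
have /(cLnorm_eq0 p1 mx) {}x0 : cLnorm mu p x = 0%E by rewrite -cLnorm_Lp_fin x0.
have pi0 : \pi_Lp 0 = (0 : Lp) by rewrite piE.
rewrite -pi0 -[x]reprK; apply/Lp_piP.
exact: x0.
Qed.

HB.instance Definition _ := Lmodule_isNormed.Build R[i] Lp
  Lp_normD Lp_normZ Lp_norm0_eq0.

Definition Lp_ge0 (x : Lp) := {ae mu, forall t, 0 <= x t}.

Definition positive_operator (T : Lp -> Lp) := forall x, Lp_ge0 x -> Lp_ge0 (T x).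

End Lp_space.

Section operators.
Context (R : realType) (X : normedModType R[i]).
Implicit Types (T S : {linear X -> X}) (z : R[i]).

(* Operator norm, with value +oo on unbounded maps. The norm of X takes values
   in R[i]; [complex.Re] brings it back to R. *)
Definition opnorm (f : X -> X) : \bar R :=
  ereal_sup [set (complex.Re `|f x|)%:E | x in [set x : X | `|x| <= 1]].

Lemma opnorm_lty T : bounded_near T (nbhs (0 : X)) <-> (opnorm T < +oo)%E.
Proof.
have normE (x : X) : `|x| = (complex.Re `|x|)%:C%C by rewrite RRe_real ?normr_real.
split.
  move=> /linear_boundedP/pinfty_ex_gt0[r r0 Tr].
  apply: (@le_lt_trans _ _ (complex.Re r)%:E); last exact: ltry.
  apply: ge_ereal_sup => _ [x /= x1 <-]; rewrite lee_fin -lecR -normE.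
  rewrite RRe_real ?gtr0_real// (le_trans (Tr x))//.
  by rewrite ler_piMr// ltW.
move=> Too; apply/ex_bound; exists (fine (opnorm T))%:C%C.
have T0 : (0 <= opnorm T)%E.
  apply: ereal_sup_ubound; exists 0 => /=; first by rewrite normr0.
  by rewrite linear0 normr0.
apply/nbhs_norm0P; exists 1 => //= x /= x1; rewrite normE lecR -lee_fin.
rewrite fineK ?ge0_fin_numE//; apply: ereal_sup_ubound.
by exists x => //=; exact: ltW.
Qed.

(* [S] is the bounded inverse of [z - T]. *)
Definition is_resolvent T z S :=
  [/\ bounded_near S (nbhs (0 : X)),
      cancel (fun x => z *: x - T x) S &
      cancel S (fun x => z *: x - T x)].

Definition resolvent_set T := [set z | exists S, is_resolvent T z S].

Definition spectrum T := ~` resolvent_set T.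

Definition strongly_Kreiss_bounded T :=
  spectrum T `<=` [set z | `|z| <= 1] /\
  exists2 C : R, 0 < C & forall z S (k : nat),
    1 < `|z| -> (1 <= k)%N -> is_resolvent T z S ->
    (opnorm (iter k S) <= (C / (complex.Re `|z| - 1) ^+ k)%:E)%E.

End operators.

(* [hoelder_conjugate 1 = +oo], so [pbar 1 = +oo]; the inverse in [\bar R]
   satisfies [+oo^-1 = 0]. *)
Definition pbar (R : realType) (p : R) : \bar R :=
  maxe p%:E (hoelder_conjugate p%:E).

(* Main.v *)
(* For large real lambda the resolvent of a positive T is positive, and its k-th
   power at lambda = k / N dominates the Poisson average of the T^n x, x >= 0.
   Letting k be large, the Kreiss bound and Stirling's formula give, for
   L ~ sqrt N,  || sum_{j < L} T^(N - j) x || <= C L ||x||.  Now use the order of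
   L^p in two ways:
   - sum_j ||x_j||^p <= || sum_j x_j ||^p for x_j >= 0 (the value 1 - 1/p);
   - positive x_j, j < L, have a common upper bound z with
     ||z||^p <= sum_j ||x_j||^p, and T^N x = T^(N - j) (T^j x) <= T^(N - j) z for
     z dominating the T^j x (the value 1/p, with no duality needed).
   Each yields ||T^N|| <= C L^theta max_{n < L} ||T^n|| on the positive cone, with
   theta = 1 - 1/p or 1/p. Iterating N -> sqrt N about log log N times gives
   N^(theta / 2 + theta / 4 + ...) = N^theta times a power of log N. *)
Require Import Defs.
From HB Require Import structures.
From mathcomp Require Import all_boot all_order all_algebra.
From mathcomp Require Import complex.
From mathcomp Require Import all_classical all_reals all_analysis measurable_realfun.
From mathcomp Require Import ring lra zify.

Set Implicit Arguments.
Unset Strict Implicit.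
Unset Printing Implicit Defensive.

Import Order.TTheory GRing.Theory Num.Theory.
Import numFieldNormedType.Exports.

Local Open Scope classical_set_scope.
Local Open Scope ring_scope.

(** * Elementary inequalities: real powers, a Stirling bound, binomial weights *)

Lemma powRD_ge (R : realType) (p a b : R) : 1 <= p -> 0 <= a -> 0 <= b ->
  a `^ p + b `^ p <= (a + b) `^ p.
Proof.
move=> p1 a0 b0; have p0 : 0 < p by lra.
rewrite -!(mulr_powRB1 _ p0) ?addr_ge0// mulrDl.
have q0 : 0 <= p - 1 by rewrite subr_ge0.
have ab0 : a + b \is Num.nneg by rewrite nnegrE addr_ge0.
apply: lerD; apply: ler_wpM2l => //.
  by apply: (ge0_ler_powR q0); rewrite ?nnegrE ?lerDl.
by apply: (ge0_ler_powR q0); rewrite ?nnegrE ?lerDr.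
Qed.

Lemma maxr_powR_le (R : realType) (p a b : R) :
  Num.max a b `^ p <= a `^ p + b `^ p.
Proof. by rewrite maxEle; case: ifP => _; rewrite ?lerDr ?lerDl powR_ge0. Qed.

(** The difference of the two sides is 0 at 0, and its derivative [1 - (1 - 2x) e^(2x)] is
    nonnegative because [1 - 2x <= e^(-2x)]. This yields the sharp estimate needed for Stirling's
    formula. *)
Lemma expR2_le (R : realType) (t : R) : 0 <= t -> (1 - t) * expR (2 * t) <= 1 + t.
Proof.
move=> t0; pose f (x : R) := 1 + x - (1 - x) * expR (2 * x).
pose f' (x : R) := 1 - (1 - 2 * x) * expR (2 * x).
have df (x : R) : is_derive x 1 f (f' x).
  rewrite /f; apply: is_derive_eq.
  rewrite /f' /GRing.scale /=; ring.
suff : f 0 <= f t by rewrite /f !(mulr0, addr0, subr0, expR0, mulr1); lra.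
apply: (@ger0_derive1_ndecry _ f 0) => //.
- move=> x _; rewrite derive1E derive_val /f' subr_ge0.
  have := ler_wpM2r (expR_ge0 (2 * x)) (expR_ge1Dx (- (2 * x))).
  by rewrite -expRD addNr expR0; lra.
- apply: continuous_subspaceT => x.
  by apply: differentiable_continuous; apply/derivable1_diffP.
Qed.

(** This is [n! <= e sqrt(n) (n / e)^n], squared to avoid square roots. By induction, the step
    amounts to [e <= (1 + 1/n)^(n + 1/2)], squared as well. *)
Lemma stirling_sqr (R : realType) (n : nat) : (0 < n)%N ->
  ((n`!%:R : R) * expR n%:R) ^+ 2 <= expR 2 * n%:R ^+ (2 * n).+1.
Proof.
elim: n => // -[_ _|n IH _]; first by rewrite expr1n mul1r -expRM_natr mul1r mulr1.
have {IH} := IH isT.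
set m := n.+1; set a : R := m%:R; set E := expR a => IH.
have a0 : 0 < a by rewrite ltr0n.
have m1E : m.+1%:R = a + 1 :> R by rewrite -natr1.
have step : expR 2 * a ^+ (2 * m).+1 <= (a + 1) ^+ (2 * m).+1.
  (* This [t] is chosen so that [(1 + t) / (1 - t) = (a + 1) / a]; the exponent [2m + 1] is exactly
     [1 / t]. *)
  pose t : R := (a + (a + 1))^-1.
  have c0 : 0 < a + (a + 1) by lra.
  have t0 : 0 <= t by rewrite invr_ge0 ltW.
  have h : expR (2 * t) <= (a + 1) / a.
    have := expR2_le t0.
    have -> : 1 - t = (2 * a) * t by rewrite /t; field; rewrite gt_eqF.
    have -> : 1 + t = (2 * (a + 1)) * t by rewrite /t; field; rewrite gt_eqF.
    rewrite mulrAC ler_pM2r ?invr_gt0// ler_pdivlMr//; lra.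
  have -> : expR 2 = expR (2 * t) ^+ (2 * m).+1 :> R.
    rewrite -expRM_natr; congr expR.
    have -> : ((2 * m).+1)%:R = a + (a + 1) :> R by rewrite -natr1 natrM /a; ring.
    by rewrite -mulrA mulVf ?mulr1// gt_eqF.
  rewrite -exprMn; apply: lerXn2r; rewrite ?nnegrE.
  - by rewrite mulr_ge0 ?expR_ge0// ltW.
  - lra.
  - by rewrite -ler_pdivlMr.
rewrite factS natrM m1E expRD -/E.
have -> : ((a + 1) * m`!%:R * (E * expR 1)) ^+ 2
    = (a + 1) ^+ 2 * expR 2 * (m`!%:R * E) ^+ 2.
  have -> : expR 2 = expR 1 ^+ 2 :> R by rewrite -expRM_natr mul1r.
  ring.
apply: (le_trans (ler_wpM2l _ IH)); first by rewrite mulr_ge0 ?expR_ge0 ?sqr_ge0.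
have -> : ((2 * m.+1).+1 = 2 + (2 * m).+1)%N by lia.
rewrite exprD [leRHS]mulrA [expR 2 * (a + 1) ^+ 2]mulrC.
by apply: ler_wpM2l => //; rewrite mulr_ge0 ?expR_ge0 ?sqr_ge0.
Qed.

Lemma leq_expn_ffact (k n : nat) : (k ^ n <= (n + k).-1 ^_ n)%N.
Proof.
elim: n => // n IH.
by rewrite addSn ffactnS expnS leq_mul// leq_addl.
Qed.

(** The quotient [N^_j / N^j] is the product of the [1 - i/N], [i < j], which is at least
    [1 - j^2/N >= 1/2]. The induction carries this lower bound for every [i <= j], over the integers
    so that subtraction is not truncated. *)
Lemma expn_leq_double_ffact (N j : nat) : (2 * j ^ 2 <= N)%N ->
  (N ^ j <= 2 * N ^_ j)%N.
Proof.
have [->|N0 jN] := posnP N; first by case: j.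
have h (i : nat) : (i <= j)%N ->
    (N%:Z ^+ i * (N%:Z - i%:Z ^+ 2) <= N%:Z * (N ^_ i)%:Z)%R.
  elim: i => [|i IH] ij; first by rewrite expr0 mul1r ffactn0; lia.
  have {}IH := IH (ltnW ij).
  have iN : (i <= N)%N by nia.
  rewrite ffactnSr PoszM -(subzn iN) exprS.
  have h1 : (0 <= N%:Z - i%:Z)%R by lia.
  have := ler_wpM2r h1 IH; rewrite mulrA => h2; apply: le_trans h2.
  have h3 : (0 <= N%:Z ^+ i :> int)%R by rewrite exprn_ge0.
  have h4 : (N%:Z * (N%:Z - i.+1%:Z ^+ 2) <= (N%:Z - i%:Z ^+ 2) * (N%:Z - i%:Z))%R.
    have -> : (i.+1%:Z = i%:Z + 1)%R by lia.
    nia.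
  have := ler_wpM2l h3 h4; lia.
have := h j (leqnn j).
have : (N%:Z <= 2 * (N%:Z - j%:Z ^+ 2))%R by lia.
have P0 : (0 <= N%:Z ^+ j :> int)%R by rewrite exprn_ge0.
move=> /(ler_wpM2l P0) h1 h2.
have : (N%:Z * N%:Z ^+ j <= N%:Z * (2 * (N ^_ j)%:Z))%R by lia.
rewrite ler_pM2l ?ltz_nat// => h3.
by rewrite -lez_nat PoszM -natz natrX !natz.
Qed.

(* The k-th power of the resolvent at k / N has [T ^ n] coefficient
   ['C((n + k).-1, n) (N / k) ^ n >= N ^ n / n!], the Poisson weight up to e^N. *)
Lemma resolvent_coef_ge (R : realType) (N q k j : nat) : (0 < k)%N -> (0 < N)%N ->
  (2 * q ^ 2 <= N <= 4 * q.+1 ^ 2)%N -> (j <= q)%N ->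
  expR N%:R / (4 * expR 1 * q.+1%:R) <=
  ('C((N - j + k).-1, N - j))%:R * (N%:R / k%:R) ^+ (N - j) :> R.
Proof.
move=> k0 N0 /andP[qN Nq] jq.
set n := (N - j)%N.
have jN : (j <= N)%N by nia.
have kR : 0 < k%:R :> R by rewrite ltr0n.
have NR : 0 < N%:R :> R by rewrite ltr0n.
have fR : 0 < n`!%:R :> R by rewrite ltr0n fact_gt0.
have h1 : N%:R ^+ n / n`!%:R <= ('C((n + k).-1, n))%:R * (N%:R / k%:R) ^+ n :> R.
  rewrite ler_pdivrMr// mulrAC -natrM bin_ffact exprMn mulrCA exprVn.
  rewrite ler_peMr ?exprn_ge0// ler_pdivlMr ?exprn_gt0// mul1r -natrX ler_nat.
  exact: leq_expn_ffact.
apply: le_trans h1.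
(* Moving the index from [N] down to [n = N - j] costs at most a factor 2. *)
have h2 : N%:R ^+ N / N`!%:R <= 2 * (N%:R ^+ n / n`!%:R) :> R.
  rewrite -(@ffact_fact N j)// -/n natrM.
  have -> : N%:R ^+ N = N%:R ^+ n * N%:R ^+ j :> R.
    by rewrite -exprD; congr (_ ^+ _); rewrite /n; lia.
  have cR : 0 < (N ^_ j)%:R :> R by rewrite ltr0n ffact_gt0.
  rewrite ler_pdivrMr ?mulr_gt0//.
  have -> : 2 * (N%:R ^+ n / n`!%:R) * ((N ^_ j)%:R * n`!%:R)
     = N%:R ^+ n * (2 * (N ^_ j)%:R) :> R by field; rewrite gt_eqF.
  rewrite ler_pM2l ?exprn_gt0// -natrX -natrM ler_nat.
  by apply: expn_leq_double_ffact; nia.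
have NfR : 0 < N`!%:R :> R by rewrite ltr0n fact_gt0.
(* Stirling's bound, with [sqrt N] replaced by its upper bound [2 (q + 1)]. *)
have h3 : N`!%:R * expR N%:R <= expR 1 * N%:R ^+ N * (2 * q.+1%:R) :> R.
  rewrite -ler_sqr ?nnegrE ?mulr_ge0 ?expR_ge0 ?exprn_ge0//.
  apply: (le_trans (stirling_sqr R N0)).
  have -> : (expR 1 * N%:R ^+ N * (2 * q.+1%:R)) ^+ 2 =
     expR 2 * (N%:R ^+ (2 * N) * (4 * q.+1 ^ 2)%:R) :> R.
    have -> : expR 2 = expR 1 ^+ 2 :> R by rewrite -expRM_natr mul1r.
    by rewrite mulnC exprM natrM natrX; ring.
  by rewrite ler_pM2l ?expR_gt0// exprSr ler_pM2l ?exprn_gt0// ler_nat.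
have e0 := expR_gt0 (1 : R).
have LR : 0 < q.+1%:R :> R by rewrite ltr0n.
suff : expR N%:R / (2 * expR 1 * q.+1%:R) <= N%:R ^+ N / N`!%:R :> R.
  move=> /le_trans /(_ h2).
  have -> : expR N%:R / (2 * expR 1 * q.+1%:R) =
    2 * (expR N%:R / (4 * expR 1 * q.+1%:R)) :> R by field; rewrite !gt_eqF.
  by rewrite ler_pM2l.
rewrite ler_pdivlMr// mulrAC ler_pdivrMr ?mulr_gt0//; lra.
Qed.

(** The left side is [(1 + N / (k - N))^k <= exp (k N / (k - N))], and [k N / (k - N) <= N + 1] is
    equivalent to [N^2 + N <= k]. Hence the Kreiss constant at [k / N] exceeds [e^N] by a factor [e]
    at most. *)
Lemma kreiss_const_le (R : realType) (N k : nat) : (0 < N)%N ->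
  (N ^ 2 + N <= k)%N ->
  (k%:R / N%:R) ^+ k / (k%:R / N%:R - 1) ^+ k <= expR (N%:R + 1) :> R.
Proof.
move=> N0 Nk.
have NR : 1 <= N%:R :> R by rewrite (ler_nat _ 1).
have kR : N%:R ^+ 2 + N%:R <= k%:R :> R by rewrite -natrX -natrD ler_nat.
have kN : 0 < k%:R - N%:R :> R by nra.
rewrite -expr_div_n.
have -> : k%:R / N%:R / (k%:R / N%:R - 1) = 1 + N%:R / (k%:R - N%:R) :> R.
  have N1 : 0 < N%:R :> R by lra.
  by field; rewrite !gt_eqF.
apply: (@le_trans _ _ (expR (N%:R / (k%:R - N%:R)) ^+ k)).
  apply: lerXn2r; rewrite ?nnegrE ?expR_ge0 ?expR_ge1Dx//.
  by rewrite addr_ge0// divr_ge0// ltW.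
rewrite -expRM_natr ler_expR mulrAC ler_pdivrMr//; nra.
Qed.

(** * The norm with real values, and operator norm estimates *)

Section real_norm.
Context (R : realType) (V : normedModType R[i]).
Implicit Types (x y : V) (a : R).

Definition rnorm x : R := complex.Re `|x|.

Lemma rnormE x : `|x| = (rnorm x)%:C%C.
Proof. by rewrite /rnorm RRe_real ?normr_real. Qed.

Lemma rnorm_ge0 x : 0 <= rnorm x.
Proof. by rewrite -ler0c -rnormE. Qed.

Lemma rnormD x y : rnorm (x + y) <= rnorm x + rnorm y.
Proof. by rewrite -lecR rmorphD /= -!rnormE ler_normD. Qed.

Lemma rnormN x : rnorm (- x) = rnorm x.
Proof. by rewrite /rnorm normrN. Qed.

Lemma rnorm0 : rnorm 0 = 0.
Proof. by rewrite /rnorm normr0. Qed.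

Lemma rnorm0_eq0 x : rnorm x = 0 -> x = 0.
Proof. by move=> x0; apply/eqP; rewrite -normr_eq0 rnormE x0. Qed.

Lemma rnormZ (z : R[i]) x : rnorm (z *: x) = Normc.normc z * rnorm x.
Proof.
apply: complexI; rewrite -rnormE normrZ rmorphM /= -rnormE.
by rewrite norm_normc.
Qed.

Lemma normc_real a : 0 <= a -> Normc.normc a%:C%C = a.
Proof. by move=> a0; rewrite /= expr0n /= addr0 sqrtr_sqr ger0_norm. Qed.

(** Homogeneity is assumed instead of linearity so that [f] can be an iterate, which is a bare
    function. *)
Lemma opnorm_le (f : V -> V) (K : R) :
  (forall (z : R[i]) x, f (z *: x) = z *: f x) -> (opnorm f <= K%:E)%E ->
  forall x, rnorm (f x) <= K * rnorm x.
Proof.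
move=> fZ fK x; have [x0|x0] := eqVneq x 0.
  by rewrite x0 -(scale0r (0 : V)) fZ !scale0r rnorm0 mulr0.
have xgt0 : 0 < rnorm x.
  by rewrite lt_def rnorm_ge0 andbT; apply: contra_neq x0 => /rnorm0_eq0.
rewrite mulrC -ler_pdivrMl// -lee_fin; apply: le_trans fK.
have i0 : 0 <= (rnorm x)^-1 by rewrite invr_ge0 ltW.
apply: ereal_sup_ubound; exists ((rnorm x)^-1%:C%C *: x) => /=.
  by rewrite rnormE rnormZ normc_real// mulVf ?gt_eqF.
by rewrite fZ -/(rnorm _) rnormZ normc_real.
Qed.

Lemma le_opnorm (f : V -> V) (K : R) : 0 <= K ->
  (forall x, rnorm (f x) <= K * rnorm x) -> (opnorm f <= K%:E)%E.
Proof.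
move=> K0 fK; apply: ge_ereal_sup => _ [x /= x1 <-]; rewrite lee_fin.
apply: (le_trans (fK x)); rewrite ler_piMr//.
by rewrite -lecR -rnormE.
Qed.

Lemma bounded_rnorm (T : {linear V -> V}) : bounded_near T (nbhs (0 : V)) ->
  exists2 M : R, 1 <= M & forall x, rnorm (T x) <= M * rnorm x.
Proof.
move=> /linear_boundedP/pinfty_ex_gt0[r r0 Tr].
exists (Num.max 1 (complex.Re r)); first by rewrite le_max lexx.
move=> x; apply: (@le_trans _ _ (complex.Re r * rnorm x)).
  by rewrite -lecR rmorphM /= -!rnormE RRe_real ?gtr0_real.
by rewrite ler_wpM2r ?rnorm_ge0// le_max lexx orbT.
Qed.

End real_norm.

(** * Resolvent powers on a closed convex cone on which the norm is monotone *)

Section positive_cone.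
Context (R : realType) (V : normedModType R[i]) (P : V -> Prop).
Hypothesis P0 : P 0.
Hypothesis PD : forall x y, P x -> P y -> P (x + y).
Hypothesis PZ : forall (a : R) x, 0 <= a -> P x -> P (a%:C%C *: x).
Hypothesis le_rnorm : forall x y, P x -> P (y - x) -> rnorm x <= rnorm y.
Hypothesis Pclosed : forall x,
  (forall e : R, 0 < e -> exists2 z, P z & rnorm (x - z) <= e) -> P x.
Variable T : {linear V -> V}.
Hypothesis PT : forall x, P x -> P (T x).

Lemma cone_sum (I : finType) (Q : pred I) (F : I -> V) :
  (forall i, Q i -> P (F i)) -> P (\sum_(i | Q i) F i).
Proof. by move=> PF; apply: big_ind. Qed.

Lemma cone_iter n x : P x -> P (iter n T x).
Proof. by move=> Px; elim: n => //= n; exact: PT. Qed.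

Section resolvent.
Variables (M lam : R) (S : {linear V -> V}).
Hypotheses (M0 : 0 <= M) (TM : forall x, rnorm (T x) <= M * rnorm x).
Hypotheses (lam0 : 0 < lam) (lamM : 2 * M <= lam).
Hypothesis TS : is_resolvent T lam%:C%C S.

Let l : R[i] := lam^-1%:C%C.

Lemma resolvent_eq x : lam%:C%C *: S x = x + l *: T (lam%:C%C *: S x).
Proof.
have [_ _ /(_ x)] := TS; rewrite linearZ scalerA -rmorphM mulVf ?gt_eqF// scale1r.
by move=> /= e; apply/eqP; rewrite -subr_eq e.
Qed.

(** The vector [y = lam S x] is the fixed point of [z -> x + T z / lam]. This map preserves the cone
    and, as [2 M <= lam], contracts by a factor 1/2, so its iterates from 0 are cone elements
    converging to [y], and the cone is closed. *)
Lemma cone_resolvent x : P x -> P (lam%:C%C *: S x).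
Proof.
move=> Px; set y := lam%:C%C *: S x.
have yE : y = x + l *: T y by exact: resolvent_eq.
have approx m : exists2 z, P z & rnorm (y - z) <= rnorm y / 2 ^+ m.
  elim: m => [|m [z Pz yz]]; first by exists 0; rewrite // subr0 divr1.
  exists (x + l *: T z).
    by apply: PD => //; apply: PZ; [rewrite invr_ge0 ltW|exact: PT].
  rewrite {1}yE opprD addrACA subrr add0r -scalerBr -linearB rnormZ.
  rewrite normc_real; last by rewrite invr_ge0 ltW.
  rewrite ler_pdivrMl//.
  apply: (le_trans (TM _)).
  have := ler_wpM2l M0 yz; move=> /le_trans; apply.
  have -> : rnorm y / 2 ^+ m.+1 = rnorm y / 2 ^+ m / 2.
    by rewrite exprSr invfM mulrA.
  have h : 0 <= rnorm y / 2 ^+ m by rewrite divr_ge0 ?rnorm_ge0 ?exprn_ge0.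
  by have := ler_wpM2r h lamM; lra.
apply: Pclosed => e e0.
have re0 : 0 <= rnorm y / e by rewrite divr_ge0 ?rnorm_ge0 ?ltW.
have [z Pz yz] := approx (Num.bound (rnorm y / e)); exists z => //.
apply: (le_trans yz); rewrite ler_pdivrMr ?exprn_gt0// mulrC -ler_pdivrMr//.
apply: (le_trans (ltW (archi_boundP re0))).
by rewrite -natrX ler_nat ltnW// ltn_expl.
Qed.

Let w k x := iter k (fun y => lam%:C%C *: S y) x.

(** The coefficient of [T^n] in the expansion of [(1 - T / lam)^(-k)]. For [k = 0] the truncated
    predecessor gives 1 at [n = 0] and 0 at [n > 0], as required. *)
Let coef k n : R := 'C((n + k).-1, n)%:R * lam^-1 ^+ n.

(** Remainders of the expansion lie in the cone, without any convergence argument. By Pascal's rule,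
    the remainder for [(k + 1, m + 1)] is the one for [(k, m + 1)] plus [T / lam] applied to the one
    for [(k + 1, m)]; hence the nested induction. *)
Lemma resolvent_powers_ge k m x : P x ->
  P (w k x - \sum_(n < m) (coef k n)%:C%C *: iter n T x).
Proof.
move=> Px; have Pw i : P (w i x).
  by elim: i => //= i; exact: cone_resolvent.
have coef0 i : coef i 0 = 1 by rewrite /coef bin0 mulr1.
elim: k m => [|k IHk] m.
  case: m => [|m]; first by rewrite big_ord0 subr0.
  rewrite big_ord_recl coef0 scale1r big1 ?addr0 ?subrr// => i _.
  by rewrite /coef addn0 /= bin_small// mul0r scale0r.
elim: m => [|m IHm]; first by rewrite big_ord0 subr0.
have -> : w k.+1 x - \sum_(n < m.+1) (coef k.+1 n)%:C%C *: iter n T x =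
    (w k x - \sum_(n < m.+1) (coef k n)%:C%C *: iter n T x) +
    l *: T (w k.+1 x - \sum_(n < m) (coef k.+1 n)%:C%C *: iter n T x).
  have wE : w k.+1 x = w k x + l *: T (w k.+1 x) by exact: resolvent_eq.
  rewrite {1}wE [T (_ - _)]linearB [T (\sum_(_ < _) _)]linear_sum scalerBr.
  rewrite scaler_sumr addrACA -opprD.
  congr (_ - _); rewrite !big_ord_recl !coef0 -addrA; congr (_ + _).
  rewrite -big_split; apply: eq_bigr => i _ /=.
  rewrite linearZ scalerA -rmorphM -scalerDl -rmorphD; congr (_%:C%C *: _).
  rewrite /coef /bump /= add1n addnS !add0n /= binS natrD exprS; ring.
by apply: PD => //; apply: PZ; [rewrite invr_ge0 ltW|exact: PT].
Qed.

Lemma resolvent_powersE k x : w k x = (lam ^+ k)%:C%C *: iter k S x.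
Proof.
elim: k => [|k IH]; first by rewrite scale1r.
by rewrite /w iterS -/(w k x) IH linearZ scalerA -rmorphM -exprS.
Qed.

(** In the partial sum up to [T^N], the terms of index below [N - q] are dropped and the remaining
    coefficients are lowered to [a]; both changes subtract a cone element, so monotonicity of the
    norm applies. *)
Lemma block_le_resolvent N q k (a : R) x : 0 <= a -> P x -> (q <= N)%N ->
  (forall j, (j <= q)%N -> a <= coef k (N - j)) ->
  a * rnorm (\sum_(j < q.+1) iter (N - j) T x) <= lam ^+ k * rnorm (iter k S x).
Proof.
move=> a0 Px qN acoef.
have lk0 : 0 <= lam ^+ k by rewrite exprn_ge0 ?ltW.
have coef_ge0 n : 0 <= coef k n by rewrite mulr_ge0// exprn_ge0// invr_ge0 ltW.
rewrite -(normc_real a0) -rnormZ -(normc_real lk0) -rnormZ -resolvent_powersE.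
apply: le_rnorm.
  by apply: PZ => //; apply: cone_sum => i _; exact: cone_iter.
rewrite -[w k x](subrK (\sum_(n < N.+1) (coef k n)%:C%C *: iter n T x)) -addrA.
apply: PD; first exact: resolvent_powers_ge.
(* Reversal puts the index in the form [N - j]; the block is then [j < q + 1]. *)
rewrite (reindex_inj rev_ord_inj) (bigID (fun i : 'I_N.+1 => (i < q.+1)%N)) /=.
rewrite (@big_ord_widen _ _ _ _ N.+1 (fun j => iter (N - j) T x))//.
rewrite scaler_sumr addrAC -sumrB.
apply: PD; apply: cone_sum => i iq; rewrite subSS.
  rewrite -scalerBl -rmorphB; apply: PZ; last exact: cone_iter.
  by rewrite subr_ge0 acoef.
by apply: PZ; last exact: cone_iter.
Qed.

End resolvent.

Lemma kreiss_block_bound : bounded_near T (nbhs (0 : V)) ->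
  strongly_Kreiss_bounded T ->
  exists2 C : R, 0 < C & forall (N q : nat) x, (0 < N)%N ->
    (2 * q ^ 2 <= N <= 4 * q.+1 ^ 2)%N -> P x ->
    rnorm (\sum_(j < q.+1) iter (N - j) T x) <= C * q.+1%:R * rnorm x.
Proof.
move=> /bounded_rnorm[M M1 TM] [spT [C C0 kreiss]].
have e0 := expR_gt0 (1 : R).
(* The factor [4 e] comes from [resolvent_coef_ge], the other [e] from [kreiss_const_le]. *)
exists (4 * expR 1 ^+ 2 * C); first by rewrite !mulr_gt0 ?exprn_gt0.
move=> N q x N0 Nq Px.
have M20 : 0 <= 2 * M by lra.
(* The summand [N^2 + N] serves [kreiss_const_le]; the last one ensures [2 M <= k / N], which
   [cone_resolvent] needs. *)
pose k := (N ^ 2 + N + N * Num.bound (2 * M))%N.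
have kN : (N ^ 2 + N <= k)%N by exact: leq_addr.
have k0 : (0 < k)%N by lia.
have NR : 0 < N%:R :> R by rewrite ltr0n.
pose lam : R := k%:R / N%:R.
have lamM : 2 * M <= lam.
  rewrite ler_pdivlMr// (le_trans (ler_wpM2r (ltW NR) (ltW (archi_boundP M20))))//.
  by rewrite -natrM ler_nat /k; lia.
have lam1 : 1 < lam.
  by rewrite ltr_pdivlMr// mul1r ltr_nat; nia.
have lam0 : 0 < lam by lra.
have normlam : `|lam%:C%C| = lam%:C%C by rewrite ger0_norm// ler0c ltW.
have [S TS] : resolvent_set T lam%:C%C.
  apply: contrapT => /spT /=; rewrite normlam.
  by rewrite (_ : 1 = 1%:C%C)// lecR leNgt lam1.
have Sk : rnorm (iter k S x) <= C / (lam - 1) ^+ k * rnorm x.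
  apply: opnorm_le; first by move=> z y; elim: (k) => //= n ->; rewrite linearZ.
  have := kreiss lam%:C%C S k; rewrite normlam /=; apply => //.
  by rewrite (_ : 1 = 1%:C%C)// ltcR.
have LR : 0 < q.+1%:R :> R by rewrite ltr0n.
pose a : R := expR N%:R / (4 * expR 1 * q.+1%:R).
have a0 : 0 < a by rewrite divr_gt0 ?expR_gt0// !mulr_gt0.
have qN : (q <= N)%N by have /andP[h _] := Nq; apply: leq_trans h; clear; nia.
have M0 : 0 <= M by lra.
have := @block_le_resolvent M lam S M0 TM lam0 lamM TS N q k a x (ltW a0) Px qN.
rewrite invf_div => /(_ (fun j => resolvent_coef_ge R k0 N0 Nq)) h.
 rewrite -(ler_pM2l a0); apply: (le_trans h).
apply: (le_trans (ler_wpM2l _ Sk)); first by rewrite exprn_ge0// ltW.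
rewrite mulrA [leRHS]mulrA ler_wpM2r ?rnorm_ge0//.
have -> : a * (4 * expR 1 ^+ 2 * C * q.+1%:R) = C * expR (N%:R + 1).
  by rewrite expRD /a; field; rewrite !gt_eqF.
rewrite mulrCA ler_pM2l//; exact: kreiss_const_le.
Qed.

End positive_cone.

(** * The order of [Lp]: its positive cone is closed and the norm is monotone on it *)

Section Lp_lattice.
Context (R : realType) (d : measure_display) (Omega : measurableType d)
  (mu : {measure set Omega -> \bar R}) (p : R) (p1 : (1 <= p%:E)%E).
Implicit Types x y z : Lp mu p1.

Lemma Lp_cLnorm x : (rnorm x)%:E = cLnorm mu p%:E x.
Proof. by rewrite -cLnorm_Lp_fin. Qed.

Lemma Lp_cmeasurable x : cmeasurable (x : Omega -> R[i]).
Proof. by have [] := cLfunP (repr x). Qed.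

Lemma Lp_subE x y : {ae mu, forall t, Lp_fun (x - y) t = x t - y t}.
Proof.
rewrite -scaleN1r.
apply: filterS2 (Lp_addE x (-1 *: y)) (Lp_scaleE (-1) y) => t -> ->.
by rewrite mulN1r.
Qed.

Lemma Lp_zeroE : {ae mu, forall t, Lp_fun (0 : Lp mu p1) t = 0}.
Proof.
by have := Lp_subE 0 0; rewrite subrr; apply: filterS => t ->; rewrite subrr.
Qed.

Lemma Lp_le_rnorm x y :
  {ae mu, forall t, Normc.normc (x t) <= Normc.normc (y t)} -> rnorm x <= rnorm y.
Proof.
move=> xy; rewrite -lee_fin !Lp_cLnorm; apply: ae_le_Lnorm => //.
- exact/cmeasurable_normc/Lp_cmeasurable.
- exact/cmeasurable_normc/Lp_cmeasurable.
- by apply: filterS xy => t; rewrite /= !ger0_norm ?normc_ge0.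
Qed.

(** Used to bring pointwise constructions, such as positive parts and maxima, back into [Lp]. *)
Lemma Lp_real_ex (f : Omega -> R) y : measurable_fun setT f ->
  {ae mu, forall t, `|f t| <= Normc.normc (y t)} ->
  exists x, {ae mu, forall t, x t = (f t)%:C%C}.
Proof.
move=> mf fy; pose g t : R[i] := (f t)%:C%C.
have mg : cmeasurable g by split => //; exact: measurable_cst.
have ng t : Normc.normc (g t) = `|f t| by rewrite /= expr0n /= addr0 sqrtr_sqr.
have gP : g \in cLfun mu p1.
  rewrite inE; split => //; apply: (@le_lt_trans _ _ (rnorm y)%:E); last exact: ltry.
  rewrite Lp_cLnorm; apply: ae_le_Lnorm => //.
  - exact: cmeasurable_normc.
  - exact/cmeasurable_normc/Lp_cmeasurable.
  - apply: filterS fy => t fyt.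
    rewrite -[leLHS]/`|Normc.normc (g t)| -[leRHS]/`|Normc.normc (y t)|.
    by rewrite ng normr_id [leRHS]ger0_norm ?normc_ge0.
exists (\pi_(Lp mu p1) (CLfun gP))%qT; exact: Lp_piE.
Qed.

Lemma Lp_ge0_0 : Lp_ge0 (0 : Lp mu p1).
Proof. by apply: filterS Lp_zeroE => t ->. Qed.

Lemma Lp_ge0D x y : Lp_ge0 x -> Lp_ge0 y -> Lp_ge0 (x + y).
Proof.
move=> x0 y0; apply: filterS3 (Lp_addE x y) x0 y0 => t -> /= xt yt.
exact: addr_ge0.
Qed.

Lemma Lp_ge0Z (a : R) x : 0 <= a -> Lp_ge0 x -> Lp_ge0 (a%:C%C *: x).
Proof.
move=> a0; apply: filterS2 (Lp_scaleE a%:C%C x) => t -> /= xt.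
by rewrite mulr_ge0// ler0c.
Qed.

Lemma ge0_ReE (z : R[i]) : 0 <= z -> z = (complex.Re z)%:C%C.
Proof. by move=> z0; rewrite RRe_real ?ger0_real. Qed.

Lemma ge0_normc (z : R[i]) : 0 <= z -> Normc.normc z = complex.Re z.
Proof. by move=> z0; rewrite -Re_norm ger0_norm. Qed.

Lemma le_normc_ge0 (z w : R[i]) : 0 <= z -> z <= w -> Normc.normc z <= Normc.normc w.
Proof.
move=> z0 zw; rewrite !ge0_normc ?(le_trans z0)//.
by move: zw; rewrite lecE => /andP[].
Qed.

Lemma Lp_ge0_le_rnorm x y : Lp_ge0 x -> Lp_ge0 (y - x) -> rnorm x <= rnorm y.
Proof.
move=> x0 yx; apply: Lp_le_rnorm.
apply: filterS3 (Lp_subE y x) x0 yx => t -> /= xt; rewrite subr_ge0.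
exact: le_normc_ge0.
Qed.

Lemma normr_Re_le (z : R[i]) : `|complex.Re z| <= Normc.normc z.
Proof. by rewrite -lecR -norm_normc; exact: normc_ge_Re. Qed.

Lemma normr_Im_le (z : R[i]) : `|complex.Im z| <= Normc.normc z.
Proof.
case: z => a b /=; rewrite -sqrtr_sqr ler_sqrt ?lerDr ?sqr_ge0//.
by rewrite addr_ge0 ?sqr_ge0.
Qed.

(** The function [f], which is [|Im x|] plus the negative part of [Re x], vanishes exactly where
    [x >= 0], and [f <= 2 |x - z|] almost everywhere for every [z >= 0]. Its norm is thus
    arbitrarily small, so [f = 0] almost everywhere. *)
Lemma Lp_ge0_closed x :
  (forall e : R, 0 < e -> exists2 z, Lp_ge0 z & rnorm (x - z) <= e) -> Lp_ge0 x.
Proof.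
move=> xz.
pose f t : R := `|complex.Im (x t)| + Num.max (- complex.Re (x t)) 0.
have [mRe mIm] := Lp_cmeasurable x.
have f0 t : 0 <= f t by rewrite addr_ge0// le_max lexx orbT.
have mf : measurable_fun setT f.
  apply: measurable_funD; first exact: measurableT_comp.
  apply: measurable_maxr; last exact: measurable_cst.
  exact: measurableT_comp.
have normc2 (c : R[i]) : Normc.normc (2 * c) = 2 * Normc.normc c.
  by rewrite Normc.normcM -(rmorph_nat (real_complex R) 2) normc_real.
have fle (z : Lp mu p1) : Lp_ge0 z ->
    {ae mu, forall t, `|f t| <= Normc.normc (Lp_fun (2 *: (x - z)) t)}.
  move=> z0; apply: filterS3 (Lp_scaleE 2 (x - z)) (Lp_subE x z) z0 => t -> -> /= zt.
  rewrite normc2 ger0_norm// /f mulr_natl mulr2n; apply: lerD.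
    have -> : complex.Im (x t) = complex.Im (x t - z t).
      by rewrite (ge0_ReE zt); case: (x t) => a b /=; rewrite subr0.
    exact: normr_Im_le.
  rewrite ge_max normc_ge0 andbT.
  have zt0 : 0 <= complex.Re (z t) by rewrite -ge0_normc ?normc_ge0.
  apply: le_trans (normr_Re_le _); rewrite -normrN; apply: le_trans (ler_norm _).
  rewrite (_ : complex.Re (x t - z t) = complex.Re (x t) - complex.Re (z t)).
    by lra.
  by case: (x t) (z t) => a b [a' b'].
(* Any approximant will do here: it only shows that [f] belongs to [Lp]. *)
have [z0 z0P _] := xz 1 ltr01.
have [w wf] := Lp_real_ex mf (fle _ z0P).
have w0 : w = 0.
  apply: rnorm0_eq0; apply/eqP; rewrite eq_le rnorm_ge0 andbT.
  apply/ler_addgt0Pl => e e0; rewrite addr0.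
  have [z zP ze] := xz (e / 2) (divr_gt0 e0 (ltr0Sn R 1)).
  apply: (@le_trans _ _ (rnorm (2 *: (x - z)))).
    apply: Lp_le_rnorm; apply: filterS2 wf (fle _ zP) => t ->.
    by rewrite /= expr0n /= addr0 sqrtr_sqr.
  rewrite rnormZ -[2]mulr1 normc2 Normc.normc1 mulr1; lra.
apply: filterS2 wf Lp_zeroE => t; rewrite w0 => -> [] ft0.
have m0 : 0 <= Num.max (- complex.Re (x t)) 0 by rewrite le_max lexx orbT.
have i0 := normr_ge0 (complex.Im (x t)).
have r0 : - complex.Re (x t) <= Num.max (- complex.Re (x t)) 0 by rewrite le_max lexx.
rewrite lecE /= -normr_eq0 eq_le i0 andbT; move: ft0; rewrite /f => ft0.
by apply/andP; split; lra.
Qed.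

End Lp_lattice.

(** * Powers of the norm, suprema, and iterates of a positive operator *)

Lemma powR_le_cancel (R : realType) (p a b : R) : 0 < p -> 0 <= a -> 0 <= b ->
  a `^ p <= b `^ p -> a <= b.
Proof.
move=> p0 a0 b0; apply: contraTT; rewrite -!ltNge => ba.
exact: gt0_ltr_powR.
Qed.

Section Lp_powers.
Context (R : realType) (d : measure_display) (Omega : measurableType d)
  (mu : {measure set Omega -> \bar R}) (p : R) (p1 : (1 <= p%:E)%E).
Implicit Types x y z : Lp mu p1.

Let p_ge1 : 1 <= p. Proof. by rewrite -lee_fin. Qed.
Let p_gt0 : 0 < p. Proof. exact: lt_le_trans p_ge1. Qed.

Let normp x t : R := Normc.normc (x t) `^ p.

Let normp_measurable x : measurable_fun setT (fun t => (normp x t)%:E).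
Proof.
apply/measurable_EFinP; apply: (@measurableT_comp _ _ _ _ _ _ (@powR R ^~ p)) => //.
exact/cmeasurable_normc/Lp_cmeasurable.
Qed.

Let normp_ge0 x t : (0 <= (normp x t)%:E)%E.
Proof. by rewrite lee_fin powR_ge0. Qed.

Lemma rnorm_powR x : ((rnorm x) `^ p)%:E = (\int[mu]_t (normp x t)%:E)%E.
Proof.
rewrite -poweR_EFin Lp_cLnorm powR_Lnorm ?gt_eqF//.
apply: eq_integral => t _; congr ((_ `^ _)%:E).
by rewrite ger0_norm// normc_ge0.
Qed.

Lemma rnorm_powRD x y : Lp_ge0 x -> Lp_ge0 y ->
  rnorm x `^ p + rnorm y `^ p <= rnorm (x + y) `^ p.
Proof.
move=> x0 y0; rewrite -lee_fin EFinD !rnorm_powR -ge0_integralD//.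
apply: ae_ge0_le_integral => //.
- by move=> t _; rewrite adde_ge0// normp_ge0.
- by apply: emeasurable_funD; exact: normp_measurable.
apply: filterS3 (Lp_addE x y) x0 y0 => t xyt xt yt _ /=.
rewrite -EFinD lee_fin /normp xyt !ge0_normc ?addr_ge0// ReDc.
by apply: powRD_ge => //; rewrite -ge0_normc ?normc_ge0.
Qed.

(** The pointwise maximum works: it lies in [Lp] because it is at most [x + y], and
    [max(a, b)^p <= a^p + b^p] is integrated. *)
Lemma Lp_sup_ex x y : Lp_ge0 x -> Lp_ge0 y ->
  exists z, [/\ Lp_ge0 (z - x), Lp_ge0 (z - y) &
    rnorm z `^ p <= rnorm x `^ p + rnorm y `^ p].
Proof.
move=> x0 y0.
pose f t : R := Num.max (complex.Re (x t)) (complex.Re (y t)).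
have mf : measurable_fun setT f.
  by apply: measurable_maxr; [have [] := Lp_cmeasurable x|have [] := Lp_cmeasurable y].
have Re_ge0 (c : R[i]) : 0 <= c -> 0 <= complex.Re c.
  by move=> c0; rewrite -ge0_normc ?normc_ge0.
have [z zf] : exists z, {ae mu, forall t, z t = (f t)%:C%C}.
  apply: (@Lp_real_ex _ _ _ _ _ _ _ (x + y)) => //.
  apply: filterS3 (Lp_addE x y) x0 y0 => t -> xt yt /=.
  rewrite ge0_normc ?addr_ge0// ReDc ger0_norm ?le_max ?Re_ge0//.
  by rewrite /f ge_max lerDl lerDr !Re_ge0.
exists z; split.
- apply: filterS3 (Lp_subE z x) zf x0 => t -> -> /= xt.
  by rewrite [x t]ge0_ReE// -rmorphB ler0c subr_ge0 /f le_max lexx.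
- apply: filterS3 (Lp_subE z y) zf y0 => t -> -> /= yt.
  by rewrite [y t]ge0_ReE// -rmorphB ler0c subr_ge0 /f le_max lexx orbT.
- rewrite -lee_fin EFinD !rnorm_powR -ge0_integralD//.
  apply: ae_ge0_le_integral => //.
  + by move=> t _; rewrite adde_ge0// normp_ge0.
  + by apply: emeasurable_funD; exact: normp_measurable.
  apply: filterS3 zf x0 y0 => t zt xt yt _ /=.
  rewrite -EFinD lee_fin /normp zt normc_real ?le_max ?Re_ge0// !ge0_normc//.
  exact: maxr_powR_le.
Qed.

Lemma Lp_ge0_sum n (F : 'I_n -> Lp mu p1) : (forall i, Lp_ge0 (F i)) ->
  Lp_ge0 (\sum_(i < n) F i).
Proof.
by move=> F0; apply: (big_ind (@Lp_ge0 _ _ _ mu _ p1)) => //;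
  [exact: Lp_ge0_0|exact: Lp_ge0D].
Qed.

Lemma rnorm_powR_sum n (F : nat -> Lp mu p1) : (forall i, Lp_ge0 (F i)) ->
  \sum_(i < n) rnorm (F i) `^ p <= rnorm (\sum_(i < n) F i) `^ p.
Proof.
move=> F0; elim: n => [|n IH]; first by rewrite !big_ord0 powR_ge0.
rewrite !big_ord_recr /=; apply: (le_trans (lerD IH (lexx _))).
apply: rnorm_powRD => //.
exact: Lp_ge0_sum.
Qed.

Lemma Lp_sup_seq_ex n (F : nat -> Lp mu p1) : (forall i, Lp_ge0 (F i)) ->
  exists z, [/\ Lp_ge0 z, forall i, (i < n)%N -> Lp_ge0 (z - F i) &
    rnorm z `^ p <= \sum_(i < n) rnorm (F i) `^ p].
Proof.
move=> F0; elim: n => [|n [z [z0 zF zn]]].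
  by exists 0; split; [exact: Lp_ge0_0| |rewrite big_ord0 rnorm0 powR0// gt_eqF].
have [w [wz wF wn]] := Lp_sup_ex z0 (F0 n).
exists w; split.
- by rewrite -[w](subrK z); apply: Lp_ge0D.
- move=> i; rewrite ltnS leq_eqVlt => /predU1P[->//|/zF zi].
  by rewrite -[w](subrK z) -addrA; apply: Lp_ge0D.
- by rewrite big_ord_recr /=; apply: (le_trans wn); rewrite lerD2r.
Qed.

Let part_ex x (f : Omega -> R) : measurable_fun setT f -> (forall t, 0 <= f t) ->
  (forall t, f t <= Normc.normc (x t)) ->
  exists z, [/\ Lp_ge0 z, rnorm z <= rnorm x & {ae mu, forall t, z t = (f t)%:C%C}].
Proof.
move=> mf f0 fx; have [|z zf] := @Lp_real_ex _ _ _ _ _ p1 _ x mf.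
  by apply: nearW => t; rewrite ger0_norm.
exists z; split => //; first by apply: filterS zf => t ->; rewrite ler0c.
by apply: Lp_le_rnorm; apply: filterS zf => t ->; rewrite normc_real.
Qed.

(** Positive and negative parts of [Re x] and [Im x], each pointwise at most [|x|]. The four pieces
    account for the factor 4 in [opnorm_le_cone]. *)
Lemma Lp_ge0_decomp x : exists a b c e,
  [/\ x = (a - b) + (0 +i* 1)%C *: (c - e),
      [/\ Lp_ge0 a, Lp_ge0 b, Lp_ge0 c & Lp_ge0 e] &
      [/\ rnorm a <= rnorm x, rnorm b <= rnorm x,
          rnorm c <= rnorm x & rnorm e <= rnorm x]].
Proof.
have [mRe mIm] := Lp_cmeasurable x.
have pos (h : Omega -> R) : measurable_fun setT h ->
    (forall t, `|h t| <= Normc.normc (x t)) -> exists z,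
    [/\ Lp_ge0 z, rnorm z <= rnorm x &
        {ae mu, forall t, z t = (Num.max (h t) 0)%:C%C}].
  move=> mh hx; apply: part_ex.
  - by apply: measurable_maxr => //; exact: measurable_cst.
  - by move=> t; rewrite le_max lexx orbT.
  - move=> t; rewrite ge_max normc_ge0 andbT.
    exact: le_trans (ler_norm _) (hx t).
have neg (h : Omega -> R) : measurable_fun setT h -> measurable_fun setT (fun t => - h t).
  by move=> mh; exact: measurableT_comp.
have [||a [a0 an aE]] := pos (complex.Re \o x) => //.
  by move=> t; exact: normr_Re_le.
have [||b [b0 bn bE]] := pos (fun t => - (complex.Re \o x) t); first exact: neg.
  by move=> t; rewrite normrN; exact: normr_Re_le.
have [||c [c0 cn cE]] := pos (complex.Im \o x) => //.
  by move=> t; exact: normr_Im_le.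
have [||e [e0 en eE]] := pos (fun t => - (complex.Im \o x) t); first exact: neg.
  by move=> t; rewrite normrN; exact: normr_Im_le.
exists a, b, c, e; split => //.
have max_sub (r : R) : Num.max r 0 - Num.max (- r) 0 = r.
  by rewrite !maxEle; case: ifP; case: ifP; lra.
have ab : {ae mu, forall t, Lp_fun (a - b) t = (complex.Re (x t))%:C%C}.
  apply: filterS3 (Lp_subE a b) aE bE => t -> -> -> /=.
  by rewrite -rmorphB max_sub.
have ce : {ae mu, forall t, Lp_fun (c - e) t = (complex.Im (x t))%:C%C}.
  apply: filterS3 (Lp_subE c e) cE eE => t -> -> -> /=.
  by rewrite -rmorphB max_sub.
apply/LpP; have zE := Lp_scaleE (0 +i* 1)%C (c - e).
have sE := Lp_addE (a - b) ((0 +i* 1)%C *: (c - e)).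
apply: filterS2 (filterI ab ce) (filterI zE sE) => t [abt cet] [-> ->].
rewrite abt cet; case: (x t) => u v /=.
by apply/eqP; rewrite eq_complex /= !(mul0r, mul1r, mulr0, subr0, add0r, addr0) !eqxx.
Qed.

Variable T : {linear Lp mu p1 -> Lp mu p1}.
Hypothesis T0 : positive_operator T.

Lemma iter_linearB n x y : iter n T (x - y) = iter n T x - iter n T y.
Proof. by elim: n => //= n ->; rewrite linearB. Qed.

Lemma iter_linearD n x y : iter n T (x + y) = iter n T x + iter n T y.
Proof. by elim: n => //= n ->; rewrite linearD. Qed.

Lemma iter_linearZ n (c : R[i]) x : iter n T (c *: x) = c *: iter n T x.
Proof. by elim: n => //= n ->; rewrite linearZ. Qed.

(** The recursion runs on this one-sided notion, since order arguments see positive vectors only;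
    the operator norm enters at the very end. *)
Definition bounded_on_cone n (A : R) :=
  forall x, Lp_ge0 x -> rnorm (iter n T x) <= A * rnorm x.

Lemma opnorm_le_cone n A : 0 <= A -> bounded_on_cone n A ->
  (opnorm (iter n T) <= (4 * A)%:E)%E.
Proof.
move=> A0 TA; apply: le_opnorm; first by rewrite mulr_ge0.
move=> x; have [a [b [c [e [xE [a0 b0 c0 e0] [an bn cn en]]]]]] := Lp_ge0_decomp x.
rewrite {1}xE iter_linearD iter_linearZ !iter_linearB.
have h y : Lp_ge0 y -> rnorm y <= rnorm x -> rnorm (iter n T y) <= A * rnorm x.
  by move=> y0 yx; apply: (le_trans (TA _ y0)); rewrite ler_wpM2l.
have i1 : Normc.normc (0 +i* 1)%C = 1 :> R.
  by rewrite /= expr0n expr1n add0r sqrtr1.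
apply: (le_trans (rnormD _ _)); rewrite rnormZ i1 mul1r.
have := rnormD (iter n T a) (- iter n T b).
have := rnormD (iter n T c) (- iter n T e).
rewrite !rnormN.
have := h _ a0 an; have := h _ b0 bn; have := h _ c0 cn; have := h _ e0 en.
lra.
Qed.

Let T_iter0 n x : Lp_ge0 x -> Lp_ge0 (iter n T x).
Proof. exact: cone_iter. Qed.

Section step.
Variables (N q : nat) (C A : R).
Hypotheses (C0 : 0 < C) (A0 : 0 <= A) (qN : (q <= N)%N).
Hypothesis TC : forall x, Lp_ge0 x ->
  rnorm (\sum_(j < q.+1) iter (N - j) T x) <= C * q.+1%:R * rnorm x.
Hypothesis TA : forall n, (n <= q)%N -> bounded_on_cone n A.

Let L : R := q.+1%:R.
Let L0 : 0 < L. Proof. by rewrite ltr0n. Qed.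

Let iter_split j x : (j <= N)%N -> iter N T x = iter j T (iter (N - j) T x).
Proof. by move=> jN; rewrite -iterD subnKC. Qed.

(** Writing [T^N x = T^j (T^(N - j) x)] and summing p-th powers over [j <= q] gives [L ||T^N x||^p
    <= A^p sum_j ||T^(N - j) x||^p]. Superadditivity and the block bound make this at most
    [(A C L ||x||)^p]; the p-th root leaves [L^(1 - 1/p)]. *)
Lemma power_step_sum : bounded_on_cone N (C * L `^ (1 - p^-1) * A).
Proof.
move=> x x0; set u := rnorm (iter N T x).
have xn := rnorm_ge0 x.
have h1 : L * u `^ p <= A `^ p * (C * L * rnorm x) `^ p.
  apply: (@le_trans _ _ (A `^ p * \sum_(j < q.+1) rnorm (iter (N - j) T x) `^ p)).
    rewrite mulr_sumr.
    have -> : L * u `^ p = \sum_(j < q.+1) u `^ p.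
      by rewrite sumr_const card_ord -mulr_natl.
    apply: ler_sum => j _; rewrite -powRM ?rnorm_ge0//.
    have jq : (j <= q)%N by rewrite -ltnS.
    apply: ge0_ler_powR; rewrite ?nnegrE ?rnorm_ge0 ?mulr_ge0 ?rnorm_ge0 ?(ltW p_gt0)//.
    rewrite /u (@iter_split j) ?(leq_trans jq)//.
    by apply: (TA jq); exact: T_iter0.
  rewrite ler_wpM2l ?powR_ge0//.
  apply: (le_trans (@rnorm_powR_sum q.+1 (fun j => iter (N - j) T x)
    (fun j => T_iter0 _ x0))).
  have CL0 : 0 <= C * L * rnorm x by rewrite !mulr_ge0 ?(ltW C0) ?(ltW L0).
  by apply: ge0_ler_powR; rewrite ?nnegrE ?rnorm_ge0 ?(ltW p_gt0)//; exact: TC.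
have CA0 : 0 <= C * L `^ (1 - p^-1) * A * rnorm x.
  by rewrite !mulr_ge0 ?(ltW C0) ?powR_ge0.
apply: (powR_le_cancel p_gt0) => //; first exact: rnorm_ge0.
rewrite -(ler_pM2l L0); apply: (le_trans h1).
have Lp : L * (L `^ (1 - p^-1)) `^ p = L `^ p.
  rewrite -powRrM mulrBl mul1r mulVf ?gt_eqF//.
  by rewrite mulr_powRB1// ltW.
have LW := ltW L0; have CW := ltW C0.
rewrite !powRM ?mulr_ge0 ?powR_ge0// -Lp.
by rewrite le_eqVlt; apply/predU1P; left; ring.
Qed.

(** With [z] dominating all [T^j x], positivity gives [L T^N x <= sum_j T^(N - j) z], of norm at
    most [C L ||z||]. Moreover [||z||^p <= L (A ||x||)^p], whose root contributes [L^(1/p)]. *)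
Lemma power_step_sup : bounded_on_cone N (C * L `^ p^-1 * A).
Proof.
move=> x x0; have xn := rnorm_ge0 x.
have [z [z0 zx zn]] := @Lp_sup_seq_ex q.+1 (fun j => iter j T x) (fun j => T_iter0 j x0).
have LW := ltW L0; have CW := ltW C0.
have h1 : L * rnorm (iter N T x) <= C * L * rnorm z.
  apply: le_trans (TC z0).
  rewrite -[L]normc_real// -rnormZ.
  have -> : L%:C%C *: iter N T x = \sum_(j < q.+1) iter N T x.
    by rewrite sumr_const card_ord /L rmorph_nat scaler_nat.
  apply: Lp_ge0_le_rnorm.
    by apply: Lp_ge0_sum => j; exact: T_iter0.
  rewrite -sumrB; apply: Lp_ge0_sum => j.
  have jq : (j <= q)%N by rewrite -ltnS.
  have jN := leq_trans jq qN.
  rewrite (@iter_split (N - j)) ?leq_subr// subKn// -iter_linearB.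
  by apply: T_iter0; exact: zx.
have h2 : rnorm z <= L `^ p^-1 * (A * rnorm x).
  apply: (powR_le_cancel p_gt0); rewrite ?rnorm_ge0 ?mulr_ge0 ?powR_ge0//.
  apply: (le_trans zn).
  rewrite powRM ?mulr_ge0 ?powR_ge0// -powRrM mulVf ?gt_eqF// powRr1//.
  have -> : L * (A * rnorm x) `^ p = \sum_(j < q.+1) (A * rnorm x) `^ p.
    by rewrite sumr_const card_ord -mulr_natl.
  apply: ler_sum => j _.
  apply: ge0_ler_powR; rewrite ?nnegrE ?rnorm_ge0 ?mulr_ge0 ?(ltW p_gt0)//.
  by apply: TA => //; rewrite -ltnS.
rewrite -(ler_pM2l L0); apply: (le_trans h1).
have CL : 0 <= C * L by rewrite mulr_ge0.
by have := ler_wpM2l CL h2; lra.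
Qed.

End step.

End Lp_powers.

(** * Solving the recursion from [N] to [q], the integer part of [sqrt (N / 2)] *)

Lemma sqrt_half_ex N : exists q, (2 * q ^ 2 <= N < 2 * q.+1 ^ 2)%N.
Proof.
elim: N => [|N [q /andP[qN Nq]]]; first by exists 0%N.
have [h|h] := ltnP N.+1 (2 * q.+1 ^ 2); first by exists q; rewrite h andbT ltnW.
by exists q.+1; rewrite h; nia.
Qed.

(** The bound [G N = D N^theta (ln (N + 1))^m] reproduces itself: [q (q + 1) <= N] takes care of the
    powers, and [2 ln (q + 1) <= ln (N + 1)] gains a factor [2^m], which absorbs [C]. *)
Lemma sqrt_recursion_growth (R : realType) (B : nat -> R -> Prop)
    (theta C M : R) :
  0 <= theta -> 0 < C -> 1 <= M ->
  (forall n A A', A <= A' -> B n A -> B n A') ->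
  (forall n, B n (M ^+ n)) ->
  (forall N q A, (0 < N)%N -> (2 * q ^ 2 <= N <= 4 * q.+1 ^ 2)%N -> 0 <= A ->
    (forall n, (n <= q)%N -> B n A) -> B N (C * q.+1%:R `^ theta * A)) ->
  exists D kappa : R, [/\ 0 < D, 0 < kappa & forall N, (1 <= N)%N ->
    B N (D * N%:R `^ theta * ln N.+1%:R `^ kappa)].
Proof.
move=> th0 C0 M1 Bmono Bpow Bstep.
have [m m0 Cm] : exists2 m : nat, (0 < m)%N & C <= 2 ^+ m.
  exists (Num.bound C).+1 => //; apply: (le_trans (ltW (archi_boundP (ltW C0)))).
  by rewrite -natrX ler_nat ltnW// (ltn_trans (ltnSn _))// ltn_expl.
have ln_gt0n n : (0 < n)%N -> 0 < ln n.+1%:R :> R.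
  by move=> n0; rewrite ln_gt0// ltr1n.
have ln_mono a b : (a <= b)%N -> ln a.+1%:R <= ln b.+1%:R :> R.
  by move=> ab; rewrite ler_ln ?posrE ?ltr0n// ler_nat.
have ln2 := ln_gt0n 1%N isT.
(* Chosen so that [G 1 = M^18], which covers all [N < 18] through the trivial bound [M^n]. *)
have [D D0 DE] : exists2 D : R, 0 < D & D * ln 2 ^+ m = M ^+ 18.
  exists (M ^+ 18 / ln 2 ^+ m); last by rewrite divfK// gt_eqF// exprn_gt0.
  by rewrite divr_gt0 ?exprn_gt0//; lra.
pose G N : R := D * N%:R `^ theta * ln N.+1%:R ^+ m.
have G0 N : (0 < N)%N -> 0 <= G N.
  move=> N0; rewrite !mulr_ge0 ?powR_ge0 ?(ltW D0)//.
  by rewrite exprn_ge0// ltW// ln_gt0n.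
have Gmono a b : (0 < a)%N -> (a <= b)%N -> G a <= G b.
  move=> a0 ab; rewrite /G ler_pM ?exprn_ge0 ?mulr_ge0 ?powR_ge0 ?(ltW D0)//.
  - exact/ltW/ln_gt0n.
  - rewrite ler_wpM2l ?(ltW D0)//.
    by apply: ge0_ler_powR; rewrite ?nnegrE ?ler_nat.
  - by apply: lerXn2r; rewrite ?nnegrE ?ln_mono// ltW ?ln_gt0n// (leq_trans a0).
have G1 : G 1%N = M ^+ 18 by rewrite /G powR1 mulr1.
have key N : (0 < N)%N -> forall n, (n <= N)%N -> B n (G N).
  elim/ltn_ind: N => N IH N0 n nN.
  (* The threshold is [18 = 2 * 3^2]: from there on [q >= 3], hence [(q + 1)^2 <= 2 q^2 <= N]. *)
  have [N18|N18] := ltnP N 18.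
    apply: Bmono (Bpow n); apply: le_trans (Gmono 1%N N isT N0).
    by rewrite G1 ler_weXn2l//; lia.
  have [nN'|nN'] := ltnP n N.
    apply: (@Bmono _ (G N.-1)); first by apply: Gmono; lia.
    by apply: IH; lia.
  have {nN nN'} -> : n = N by lia.
  have [q /andP[qN Nq]] := sqrt_half_ex N.
  have q3 : (3 <= q)%N.
    rewrite ltnNge; apply/negP => q2; have : (q.+1 ^ 2 <= 3 ^ 2)%N by rewrite leq_exp2r.
    lia.
  have qltN : (q < N)%N by nia.
  have q2N : (q.+1 ^ 2 <= N)%N by nia.
  have B1 : B N (C * q.+1%:R `^ theta * G q).
    apply: Bstep => //.
    - by rewrite qN; lia.
    - by apply: G0; lia.
    - by apply: IH => //; lia.
  apply: Bmono B1; rewrite /G.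
  have ln0 : 0 <= ln q.+1%:R :> R by rewrite ltW// ln_gt0n//; lia.
  have h1 : C * ln q.+1%:R ^+ m <= ln N.+1%:R ^+ m :> R.
    apply: (@le_trans _ _ ((2 * ln q.+1%:R) ^+ m)).
      by rewrite exprMn ler_wpM2r// exprn_ge0.
    have -> : 2 * ln q.+1%:R = ln (q.+1 ^ 2)%:R :> R.
      by rewrite natrX lnXn ?ltr0n// mulr_natl.
    apply: lerXn2r; rewrite ?nnegrE.
    - by rewrite ln_ge0// (ler_nat _ 1) expn_gt0.
    - by rewrite ltW// ln_gt0n.
    - by rewrite ler_ln ?posrE ?ltr0n ?expn_gt0// ler_nat; lia.
  have h2 : q.+1%:R `^ theta * q%:R `^ theta <= N%:R `^ theta :> R.
    rewrite -powRM//; apply: ge0_ler_powR; rewrite ?nnegrE ?mulr_ge0//.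
    by rewrite -natrM ler_nat; nia.
  have -> : C * q.+1%:R `^ theta * (D * q%:R `^ theta * ln q.+1%:R ^+ m) =
    D * ((q.+1%:R `^ theta * q%:R `^ theta) * (C * ln q.+1%:R ^+ m)) by ring.
  rewrite -[leRHS]mulrA ler_pM2l// ler_pM// ?mulr_ge0 ?powR_ge0 ?exprn_ge0//.
  exact: ltW.
exists D, m%:R; split => //; first by rewrite ltr0n.
move=> N N0; rewrite powR_mulrn; last exact/ltW/ln_gt0n.
exact: key.
Qed.

(** These two values are the exponents of [power_step_sum] and [power_step_sup]. *)
Lemma fine_pbarV (R : realType) (p : R) : 1 <= p ->
  fine (pbar p)^-1 = 1 - p^-1 \/ fine (pbar p)^-1 = p^-1.
Proof.
rewrite le_eqVlt => /predU1P[<-|p1].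
  (* At [p = 1] the inverse of [+oo] is 0, which is [1 - 1/p]. *)
  by left; rewrite /pbar hoelder_conjugate1 maxey /= invr1 subrr.
have p0 : 0 < p by lra.
have -> : pbar p = (Num.max p (p / (p - 1)))%:E.
  rewrite /pbar /hoelder_conjugate /= eqe gt_eqF// -EFinB inver gt_eqF ?subr_gt0//.
  by rewrite -EFinM EFin_max.
have [h|h] := leP p (p / (p - 1)).
- left; rewrite inver gt_eqF ?divr_gt0 ?subr_gt0//=; field.
  by rewrite !gt_eqF ?subr_gt0.
- by right; rewrite inver gt_eqF.
Qed.

Theorem proposition5p2 (R : realType) (d : measure_display)
    (Omega : measurableType d) (mu : {measure set Omega -> \bar R})
    (p : R) (p1 : (1 <= p%:E)%E) (T : {linear Lp mu p1 -> Lp mu p1}) :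
  bounded_near T (nbhs (0 : Lp mu p1)) ->
  positive_operator T ->
  strongly_Kreiss_bounded T ->
  exists C kappa : R, [/\ 0 < C, 0 < kappa &
    forall N : nat, (1 <= N)%N ->
      (opnorm (iter N T) <=
       (C * N%:R `^ fine (pbar p)^-1 * (ln N.+1%:R) `^ kappa)%:E)%E].
Proof.
move=> Tb T0 TK.
have p_ge1 : 1 <= p by rewrite -lee_fin.
have pV1 : p^-1 <= 1 by rewrite invf_le1//; lra.
have pV0 : 0 <= p^-1 by rewrite invr_ge0; lra.
have [C C0 block] := @kreiss_block_bound R (Lp mu p1) (@Lp_ge0 _ _ _ mu _ p1)
  (Lp_ge0_0 mu p1) (@Lp_ge0D _ _ _ mu _ p1) (@Lp_ge0Z _ _ _ mu _ p1)
  (@Lp_ge0_le_rnorm _ _ _ mu _ p1) (@Lp_ge0_closed _ _ _ mu _ p1) T T0 Tb TK.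
have [M M1 TM] := bounded_rnorm Tb.
pose theta := fine (pbar p)^-1.
have thetaE := fine_pbarV p_ge1.
have theta0 : 0 <= theta by case: thetaE; rewrite -/theta => ->; lra.
have [||N q A N0 Nq A0 TA|D [kappa [D0 kappa0 bound]]] :=
    @sqrt_recursion_growth R (bounded_on_cone T) theta C M theta0 C0 M1.
- move=> n A A' AA' TA x x0; apply: (le_trans (TA x x0)).
  by rewrite ler_wpM2r ?rnorm_ge0.
- move=> n x _; elim: n => [|n IH]; first by rewrite mul1r.
  by rewrite iterS (le_trans (TM _))// exprS -mulrA ler_wpM2l//; lra.
- have qN : (q <= N)%N.
    by have /andP[h _] := Nq; apply: leq_trans h; clear; nia.
  have TC x := block N q x N0 Nq.
  (* Both step estimates hold for every [p]; the value of [theta] selects the one to use. *)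
  rewrite /theta; case: thetaE => ->.
    exact: power_step_sum.
  exact: power_step_sup.
exists (4 * D), kappa; split; [by rewrite mulr_gt0|by []|move=> N N1].
(* The factor 4 is isolated to match the passage from the cone to the whole space. *)
rewrite -!mulrA [D * _]mulrA; apply: opnorm_le_cone; last exact: bound.
by rewrite !mulr_ge0 ?powR_ge0// ltW.
Qed.
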